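(* Let $\phi=f+r$ be as in the context, with $\nabla f$ $L$-Lipschitz and $r$ $\rho$-weakly convex, and let $\nu>0$ be given. For a stepsize $\alpha>0$, let $\{x^k\}$ denote the sequence generated from $x^0$ by the proximal gradient method $$x^{k+1}:=\arg\min_{x\in\mathbb{R}^d}\Big[\langle\nabla f(x^k),x-x^k\rangle+r(x)+\tfrac{1}{2\alpha}\|x-x^k\|^2\Big],\qquad k=0,1,\ldots$$ Then: (i) If the level-set proximal error bound ($\ell$-PEB) holds on $[\phi^*\le\phi<\phi^*+\nu]$ with constant $c_1>0$, then for any initial point $x^0\in[\phi^*<\phi<\phi^*+\nu]$ the proximal gradient method with stepsize $\alpha\in\left(0,\frac{1}{(c_1^2+1)(L+\rho)}\right)$ converges linearly with respect to the level set $[\phi\le\phi^*]$, i.e. there is $\beta\in(0,1)$ such that $$\operatorname{dist}\left(x^{k+1},[\phi\le\phi^*]\right)\le\beta\,\operatorname{dist}\left(x^{k},[\phi\le\phi^*]\right),\quad\forall k\ge0.\qquad(\ast)$$ (ii) If $\alpha\in(0,\min\{1/L,1/\rho\})$ and the proximal gradient method converges linearly in the sense of $(\ast)$ with some $\beta\in(0,1)$, for any initial point $x^0\in[\phi^*<\phi<\phi^*+\nu]$, then $\phi$ satisfies the ($\ell$-PEB) condition on $[\phi^*\le\phi<\phi^*+\nu]$.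
   Context: Setting: $\min_{x\in\mathbb{R}^d}\phi(x)=f(x)+r(x)$, where $f:\mathbb{R}^d\to(-\infty,\infty]$ is proper lower semicontinuous and smooth on $\operatorname{dom} f$, and $r:\mathbb{R}^d\to(-\infty,\infty]$ is proper lower semicontinuous. The set of global minimizers is assumed nonempty, $\phi$ is bounded below, and $\phi^*$ denotes the minimum value. A function $r$ is $\rho$-weakly convex if $r+\frac{\rho}{2}\|\cdot\|^2$ is convex (if $\rho=0$, $1/\rho:=+\infty$). Level-set notation: $[\phi\le a]=\{x\in\mathbb{R}^d:\phi(x)\le a\}$, $[a\le\phi<b]=\{x:a\le\phi(x)<b\}$, and similarly for other inequalities. $\operatorname{dist}$ is Euclidean distance to a set. $T_\alpha(x):=\arg\min_{y\in\mathbb{R}^d}\left[\langle\nabla f(x),y-x\rangle+r(y)+\frac{1}{2\alpha}\|x-y\|^2\right]$, where $\alpha$ is the same as the stepsize of the method. ($\ell$-PEB) holds on $[\phi^*\le\phi<\phi^*+\nu]$ with constant $c_1>0$ if $\operatorname{dist}(x,[\phi\le\phi^*])\le c_1\|x-T_\alpha(x)\|$ for all $x\in[\phi^*\le\phi<\phi^*+\nu]$. *)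

(* Defs.v *)
From mathcomp Require Import all_boot all_order all_algebra.
From mathcomp Require Import all_classical all_reals all_analysis.

Set Implicit Arguments.
Unset Strict Implicit.
Unset Printing Implicit Defensive.

Import Order.TTheory GRing.Theory Num.Theory.
Import numFieldNormedType.Exports.

Local Open Scope classical_set_scope.
Local Open Scope ring_scope.

Section EuclideanSpace.
Context {R : realType} {d : nat}.
Implicit Types (x y u v : 'rV[R]_d) (A : set 'rV[R]_d).

Definition dotv u v : R := \sum_(i < d) u 0 i * v 0 i.

(* The library norm `|x| on 'rV[R]_d is the sup norm; it is used below only
   through the topology and differentiability, which do not depend on it. *)
Definition enorm u : R := Num.sqrt (dotv u u).

(* Takes the value 0 when A is empty. *)
Definition eucl_dist x A : R := inf [set enorm (x - y) | y in A].

End EuclideanSpace.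

Section ExtendedRealFunctions.
Context {R : realType} {d : nat}.
Implicit Types (g : 'rV[R]_d -> \bar R) (x y : 'rV[R]_d).

Definition edom g : set 'rV[R]_d := [set x | (g x < +oo)%E].

Definition proper_efun g : Prop := (forall x, g x != -oo%E) /\ edom g !=set0.

(* Frechet differentiability at x as a function on R^d: g is finite near x. *)
Definition smooth_on_dom g : Prop :=
  forall x, edom g x ->
    (\forall y \near x, g y \is a fin_num) /\ differentiable (fine \o g) x.

Definition grad g x : 'rV[R]_d :=
  \row_(i < d) 'D_(delta_mx 0 i) (fine \o g) x.

Definition lipschitz_grad (L : R) g : Prop :=
  forall x y, edom g x -> edom g y ->
    enorm (grad g x - grad g y) <= L * enorm (x - y).

(* With 0 * +oo = 0, the cases t = 0 and t = 1 hold trivially. *)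
Definition econvex g : Prop :=
  forall x y (t : R), 0 <= t <= 1 ->
    (g (t *: x + (1 - t) *: y)%R <= t%:E * g x + (1 - t)%:E * g y)%E.

Definition weakly_convex (rho : R) g : Prop :=
  econvex (fun x => (g x + (rho / 2 * enorm x ^+ 2)%:E)%E).

Definition argmin g : set 'rV[R]_d := [set x | forall y, (g x <= g y)%E].

Definition minval g : \bar R := ereal_inf (range g).

End ExtendedRealFunctions.

Section ProximalGradient.
Context {R : realType} {d : nat}.
Implicit Types (f r phi : 'rV[R]_d -> \bar R) (alpha nu c beta : R).
Implicit Types (x y : 'rV[R]_d).

Definition prox_model f r alpha x y : \bar R :=
  ((dotv (grad f x) (y - x))%:E + r y
     + ((2 * alpha)^-1 * enorm (x - y) ^+ 2)%:E)%E.

(* The map T_alpha. For r rho-weakly convex and 0 < alpha < 1 / rho the model is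
   strongly convex, so that its minimizer is unique; [get] selects it. *)
Definition prox_grad f r alpha x : 'rV[R]_d :=
  get (argmin (prox_model f r alpha x)).

Definition pgm f r alpha x0 (k : nat) : 'rV[R]_d :=
  iter k (prox_grad f r alpha) x0.

Definition solutions phi : set 'rV[R]_d := [set x | (phi x <= minval phi)%E].

Definition level_ge phi nu : set 'rV[R]_d :=
  [set x | (minval phi <= phi x < minval phi + nu%:E)%E].

Definition level_gt phi nu : set 'rV[R]_d :=
  [set x | (minval phi < phi x < minval phi + nu%:E)%E].

Definition level_PEB f r alpha nu c : Prop :=
  let phi := (f \+ r)%E in
  forall x, level_ge phi nu x ->
    eucl_dist x (solutions phi) <= c * enorm (x - prox_grad f r alpha x).

Definition pgm_linear f r alpha beta x0 : Prop :=
  let S := solutions (f \+ r)%E in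
  forall k : nat,
    eucl_dist (pgm f r alpha x0 k.+1) S <= beta * eucl_dist (pgm f r alpha x0 k) S.

End ProximalGradient.

(* Main.v *)
Require Import Defs.
From mathcomp Require Import all_boot all_order all_algebra.
From mathcomp Require Import all_classical all_reals all_analysis.
From mathcomp Require Import ring lra.
Import Order.TTheory GRing.Theory Num.Theory.
Import numFieldNormedType.Exports.
Local Open Scope classical_set_scope.
Local Open Scope ring_scope.

(* Write S for the solution set, x' = T_alpha(x) and D for the distance to S.
   Lower semicontinuity and the Lipschitz gradient force dom f to be the whole
   space, so the two-sided descent lemma holds everywhere. Combined with the
   strong convexity of the proximal model it gives, for every y in S,
     (1/alpha - rho) |y - x'|^2 + (1/alpha - L) |x - x'|^2
       <= (1/alpha + L) |x - y|^2,
   hence the same inequality with D(x') and D(x) in place of |y - x'| and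
   |x - y|. In (i), the error bound D(x) <= c1 |x - x'| turns it into
   D(x')^2 <= q D(x)^2, where q < 1 because
   L + c1^2 (L + rho) <= (c1^2 + 1) (L + rho) < 1/alpha; the sublevel sets are
   invariant by descent. In (ii),
   D(x) <= |x - x'| + D(x') <= |x - x'| + beta D(x). *)

(** * Euclidean inner product, norm and distance to a set *)

Section Euclidean.
Context {R : realType} {d : nat}.
Implicit Types (u v w x y : 'rV[R]_d) (A : set 'rV[R]_d).

Lemma dotvC u v : dotv u v = dotv v u.
Proof. by apply: eq_bigr => i _; rewrite mulrC. Qed.

Lemma dotvDl u v w : dotv (u + v) w = dotv u w + dotv v w.
Proof. by rewrite -big_split; apply: eq_bigr => i _; rewrite !mxE mulrDl. Qed.

Lemma dotvZl (a : R) u v : dotv (a *: u) v = a * dotv u v.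
Proof. by rewrite [RHS]mulr_sumr; apply: eq_bigr => i _; rewrite mxE mulrA. Qed.

Lemma dotvNl u v : dotv (- u) v = - dotv u v.
Proof. by rewrite -scaleN1r dotvZl mulN1r. Qed.

Lemma dotvDr u v w : dotv u (v + w) = dotv u v + dotv u w.
Proof. by rewrite dotvC dotvDl !(dotvC u). Qed.

Lemma dotvZr (a : R) u v : dotv u (a *: v) = a * dotv u v.
Proof. by rewrite dotvC dotvZl (dotvC u). Qed.

Lemma dotvNr u v : dotv u (- v) = - dotv u v.
Proof. by rewrite dotvC dotvNl (dotvC u). Qed.

Definition dotvE := (dotvDl, dotvDr, dotvZl, dotvZr, dotvNl, dotvNr).

Lemma dotv_ge0 u : 0 <= dotv u u.
Proof. by apply: sumr_ge0 => i _; rewrite -expr2 sqr_ge0. Qed.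

Lemma dotv_eq0 u : dotv u u = 0 -> u = 0.
Proof.
move=> /eqP; rewrite psumr_eq0 => [/allP u0|i _]; last by rewrite -expr2 sqr_ge0.
apply/rowP => i; rewrite mxE; apply/eqP.
by have := u0 i (mem_index_enum _); rewrite mulf_eq0 orbb.
Qed.

Lemma enorm_ge0 u : 0 <= enorm u.
Proof. exact: sqrtr_ge0. Qed.

Lemma enorm_sqr u : enorm u ^+ 2 = dotv u u.
Proof. by rewrite sqr_sqrtr ?dotv_ge0. Qed.

Lemma enormZ (a : R) u : enorm (a *: u) = `|a| * enorm u.
Proof. by rewrite /enorm !dotvE mulrA -expr2 sqrtrM ?sqr_ge0// sqrtr_sqr. Qed.

Lemma enormN u : enorm (- u) = enorm u.
Proof. by rewrite -scaleN1r enormZ normrN1 mul1r. Qed.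

Lemma CauchySchwarz_dotv u v : `|dotv u v| <= enorm u * enorm v.
Proof.
rewrite -(@ler_pXn2r _ 2) ?nnegrE ?mulr_ge0 ?enorm_ge0//.
rewrite exprMn !enorm_sqr real_normK ?num_real//.
have [v0|v0] := eqVneq (dotv v v) 0.
  by rewrite (dotv_eq0 _ v0) -(scale0r (0 : 'rV_d)) !dotvE !mul0r expr0n mulr0.
have vv : 0 < dotv v v by rewrite lt0r v0 dotv_ge0.
(* The squared norm of this vector is [dotv v v] times the gap in the Cauchy-Schwarz inequality. *)
have := dotv_ge0 (dotv v v *: u - dotv u v *: v).
rewrite !dotvE (dotvC v u) -(pmulr_rge0 _ vv) => h.
rewrite -subr_ge0 -(pmulr_rge0 _ vv) -(pmulr_rge0 _ vv).
by apply: le_trans h _; rewrite le_eqVlt; apply/orP; left; apply/eqP; ring.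
Qed.

Lemma enormD u v : enorm (u + v) <= enorm u + enorm v.
Proof.
rewrite -(@ler_pXn2r _ 2) ?nnegrE ?addr_ge0 ?enorm_ge0//.
rewrite sqrrD !enorm_sqr !dotvE (dotvC v u).
have := le_trans (ler_norm _) (CauchySchwarz_dotv u v); lra.
Qed.

(** [bounded_set] refers to the sup norm; this carries Euclidean bounds over to it. *)
Lemma norm_le_enorm u : `|u| <= enorm u.
Proof.
rewrite [leLHS]/Num.norm/= mx_normrE.
apply: bigmax_le => [|[i j] _ /=]; first exact: enorm_ge0.
rewrite -(@ler_pXn2r _ 2) ?nnegrE ?enorm_ge0// enorm_sqr real_normK ?num_real//.
rewrite [i]ord1 /dotv (bigD1 j)//= -expr2 lerDl.
by apply: sumr_ge0 => k _; rewrite -expr2 sqr_ge0.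
Qed.

Lemma continuous_dotv {T : topologicalType} (g h : T -> 'rV[R]_d) :
  continuous g -> continuous h -> continuous (fun t => dotv (g t) (h t)).
Proof.
move=> cg ch; apply: continuous_big => [|i _ t]; first exact: add_continuous.
have coord u : {for u, continuous (fun w : 'rV[R]_d => w 0 i)}.
  exact: coord_continuous.
by apply: cvgM; [exact: (continuous_comp (cg t) (coord _))|
  exact: (continuous_comp (ch t) (coord _))].
Qed.

Lemma eucl_dist_le x y A : A y -> eucl_dist x A <= enorm (x - y).
Proof.
move=> Ay; apply: ge_inf; last by exists y.
by exists 0 => _ [z _ <-]; exact: enorm_ge0.
Qed.

(** The infimum over an empty set is 0, hence the nonemptiness assumption. *)
Lemma le_eucl_dist x A (c : R) : A !=set0 ->
  (forall y, A y -> c <= enorm (x - y)) -> c <= eucl_dist x A.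
Proof.
move=> [a Aa] cle; apply: lb_le_inf; first by exists (enorm (x - a)); exists a.
by move=> _ [y Ay <-]; exact: cle.
Qed.

Lemma eucl_dist_ge0 x A : A !=set0 -> 0 <= eucl_dist x A.
Proof. by move=> A0; apply: le_eucl_dist => // y _; exact: enorm_ge0. Qed.

Lemma eucl_distD x y A : A !=set0 ->
  eucl_dist x A <= enorm (x - y) + eucl_dist y A.
Proof.
move=> A0; rewrite -lerBlDl; apply: le_eucl_dist => // z Az.
rewrite lerBlDl; apply: le_trans (eucl_dist_le x z A Az) _.
by rewrite -(subrKA y) enormD.
Qed.

End Euclidean.

(** * Derivatives along a line and the gradient *)

Section AlongLine.
Context {R : realType} {d : nat}.
Implicit Types (F : 'rV[R]_d -> R) (x v : 'rV[R]_d).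

Lemma is_derive_line F x v (t : R) : differentiable F (x + t *: v) ->
  is_derive t 1 (fun s : R => F (x + s *: v)) ('D_v F (x + t *: v)).
Proof.
move=> dF; have dv : derivable F (x + t *: v) v by exact: diff_derivable.
(* Both difference quotients coincide as functions of [h], so derivability transfers together with
   the value. *)
have E : (fun h : R => h^-1 *: (F (x + (h *: 1 + t) *: v) - F (x + t *: v))) =
    (fun h : R => h^-1 *: (F (h *: v + (x + t *: v)) - F (x + t *: v))).
  apply/funext => h; congr (_ *: (F _ - _)).
  by rewrite -[h *: 1]/(h * 1) mulr1 scalerDl addrCA.
by apply: DeriveDef; rewrite /derivable /derive E.
Qed.

(** [grad] collects partial derivatives; linearity of the differential extends the formula from
    basis vectors to [v]. *)
Lemma derive_dotv_grad (f : 'rV[R]_d -> \bar R) x v :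
  differentiable (fine \o f) x -> 'D_v (fine \o f) x = dotv (grad f x) v.
Proof.
move=> df; rewrite deriveE// [X in 'd _ _ X]row_sum_delta linear_sum.
by apply: eq_bigr => i _; rewrite linearZ mxE deriveE//= mulrC.
Qed.

End AlongLine.

(** * The descent lemma and finiteness of f on the whole space *)

Section LipschitzGradient.
Context {R : realType} {d : nat} (f : 'rV[R]_d -> \bar R) (L : R).
Hypotheses (f_proper : proper_efun f) (f_lsc : lower_semicontinuous f).
Hypotheses (L_ge0 : 0 <= L) (f_smooth : smooth_on_dom f) (grad_lip : lipschitz_grad L f).

Let F := fine \o f.

(** Mean value theorem for the first-order remainder minus its quadratic bound, whose derivative is
    nonpositive by Cauchy-Schwarz and the Lipschitz gradient. The domain is assumed only along the
    segment, because [edom_setT] is derived from this. *)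
Lemma descent_segment (x v : 'rV[R]_d) (t : R) : 0 <= t ->
  (forall s : R, 0 <= s <= t -> edom f (x + s *: v)) ->
  `|F (x + t *: v) - F x - t * dotv (grad f x) v|
    <= L / 2 * t ^+ 2 * enorm v ^+ 2.
Proof.
move=> t0 dom; have domx : edom f x.
  by rewrite -[x]addr0 -(scale0r v); apply: dom; rewrite lexx.
have dF (s : R) : 0 <= s <= t -> is_derive s 1 (fun s : R => F (x + s *: v))
    (dotv (grad f (x + s *: v)) v).
  move=> st; have [_ df] := f_smooth _ (dom _ st).
  by rewrite -derive_dotv_grad//; exact: is_derive_line.
(* The sign [e] treats both halves of the absolute value at once. *)
suff H (e : R) : `|e| = 1 ->
    e * (F (x + t *: v) - F x - t * dotv (grad f x) v)
      <= L / 2 * t ^+ 2 * enorm v ^+ 2.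
  by rewrite ler_norml lerNl -mulN1r -[X in _ && (X <= _)]mul1r !H ?normrN1 ?normr1.
move=> e1; pose k s := e * (F (x + s *: v) - s * dotv (grad f x) v)
                       - s ^+ 2 * (L / 2 * enorm v ^+ 2).
pose dk s := e * (dotv (grad f (x + s *: v)) v - dotv (grad f x) v)
             - s * (L * enorm v ^+ 2).
have kD (s : R) : 0 <= s <= t -> is_derive s 1 k (dk s).
  move=> st; have ? := dF s st.
  apply: is_derive_eq; rewrite /dk /=.
  rewrite !scaler0 ?add0r /GRing.scale/=; by field.
have [||c] := @MVT_segment _ k dk 0 t t0.
- by move=> s /[!in_itv]/= /andP[s0 st]; apply: kD; rewrite !ltW.
- by apply: derivable_within_continuous => s /[!in_itv]/= /kD[].
rewrite in_itv/= => ct; rewrite /k scale0r addr0 mul0r expr0n mul0r !subr0.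
have : dk c <= 0.
  rewrite /dk subr_le0 -dotvNl -dotvDl.
  apply: le_trans (ler_norm _) _; rewrite normrM e1 mul1r.
  apply: le_trans (CauchySchwarz_dotv _ _) _.
  have := grad_lip _ _ (dom _ ct) domx.
  rewrite addrAC subrr add0r enormZ ger0_norm ?(andP ct).1// => h.
  apply: le_trans (ler_wpM2r (enorm_ge0 _) h) _.
  by rewrite le_eqVlt; apply/orP; left; apply/eqP; ring.
by move=> /mulr_le0_ge0/(_ t0); lra.
Qed.

(* Otherwise move from a point of dom f towards y up to the first point outside
   the open set dom f: f stays bounded on the way since its gradient grows at
   most linearly, whereas lower semicontinuity makes it tend to +oo. *)
Lemma edom_setT y : edom f y.
Proof.
have [_ [x domx]] := f_proper; apply: contrapT => ndomy.
pose A : set R := [set t | 0 <= t /\ ~ edom f (x + t *: (y - x))].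
have A1 : A 1 by split; rewrite ?scale1r ?subrKC ?ler01//.
have lbA : lbound A 0 by move=> t [].
have hA : has_inf A by split; [exists 1|exists 0].
pose t := inf A; have t_ge0 : 0 <= t by apply: lb_le_inf => //; exists 1.
have domlt (s : R) : 0 <= s < t -> edom f (x + s *: (y - x)).
  case/andP => s0 st; apply: contrapT => ns.
  have : t <= s by apply: ge_inf; [exists 0|split].
  by rewrite leNgt st.
have line : {for t, continuous (fun s : R => x + s *: (y - x))}.
  by apply: continuousD; [exact: cst_continuous|exact: scalel_continuous].
(* The infimum is attained: were f finite at this point, it would be finite on a neighbourhood, and
   no element of [A] could be close to [t]. *)
have ndomt : ~ edom f (x + t *: (y - x)).
  move=> domt; have [+ _] := f_smooth _ domt.
  move=> /line/nbhs_ballP[e /= e0 te].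
  have [a [a0 na] ae] := inf_adherent e0 hA.
  have ta : t <= a by apply: ge_inf; [exists 0|split].
  apply: na; rewrite /edom/= ltey_eq; apply/orP; left; apply: te.
  by rewrite /ball/= distrC ger0_norm ?subr_ge0// ltrBlDl.
have t_gt0 : 0 < t.
  rewrite lt_neqAle t_ge0 andbT; apply: contra_notN ndomt => /eqP <-.
  by rewrite scale0r addr0.
pose C := F x + t * `|dotv (grad f x) (y - x)|
          + L / 2 * t ^+ 2 * enorm (y - x) ^+ 2.
have fC (s : R) : 0 <= s < t -> F (x + s *: (y - x)) <= C.
  move=> /[dup] /andP[s0 st] st'.
  have := @descent_segment x (y - x) s s0 _.
  have {}h : forall r : R, 0 <= r <= s -> edom f (x + r *: (y - x)).
    by move=> r /andP[r0 rs]; apply: domlt; rewrite r0 (le_lt_trans rs).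
  move=> /(_ h)/(le_trans (ler_norm _)) {}h.
  have : s * dotv (grad f x) (y - x) <= t * `|dotv (grad f x) (y - x)|.
    apply: le_trans (ler_wpM2r (normr_ge0 _) (ltW st)).
    by apply: ler_wpM2l => //; exact: ler_norm.
  have : L / 2 * s ^+ 2 * enorm (y - x) ^+ 2 <= L / 2 * t ^+ 2 * enorm (y - x) ^+ 2.
    apply: ler_wpM2r; rewrite ?sqr_ge0//; apply: ler_wpM2l; first by rewrite divr_ge0.
    by rewrite ler_pXn2r ?nnegrE// ltW.
  by rewrite /C; move: h; lra.
have /(f_lsc _ _)[V + VC] : (C%:E < f (x + t *: (y - x)))%E.
  by move: ndomt; rewrite /edom/= => /negP; rewrite -leNgt leye_eq => /eqP ->; rewrite ltry.
move=> /line/nbhs_ballP[e /= e0 te].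
(* A parameter just below [t], cut off at 0 to stay on the segment; its point lies in [V], where f
   exceeds [C], against [fC]. *)
pose s := Num.max 0 (t - e / 2).
have ts : t - e / 2 <= s by rewrite le_max lexx orbT.
have st : 0 <= s < t by rewrite le_max lexx gt_max t_gt0/=; lra.
have /VC : V (x + s *: (y - x)).
  apply: te; rewrite /ball/= ger0_norm ?subr_ge0; last by rewrite ltW// (andP st).2.
  by lra.
have := domlt s st; rewrite /edom/= => fs.
have ffin : f (x + s *: (y - x)) \is a fin_num.
  by rewrite fin_numE (f_proper.1 _) lt_eqF.
by rewrite -(fineK ffin) lte_fin ltNge fC.
Qed.

Lemma fin_num_dom y : f y \is a fin_num.
Proof. by rewrite fin_numE (f_proper.1 _) lt_eqF//; exact: edom_setT. Qed.

Lemma descent x y :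
  `|F y - F x - dotv (grad f x) (y - x)| <= L / 2 * enorm (x - y) ^+ 2.
Proof.
have := @descent_segment x (y - x) 1 ler01 (fun _ _ => edom_setT _).
by rewrite scale1r subrKC mul1r expr1n mulr1 -(enormN (y - x)) opprB.
Qed.

End LipschitzGradient.

(** * Lower semicontinuity and existence of minimizers *)

Section LowerSemicontinuous.
Context {R : realType}.

Lemma lower_semicontinuousD {T : topologicalType} (g : T -> \bar R) (c : T -> R) :
  lower_semicontinuous g -> continuous c ->
  lower_semicontinuous (fun y => (g y + (c y)%:E)%E).
Proof.
move=> lg cc x a /= agc.
(* Split [a] into [b] and [a - b], strictly below [g x] and [c x], so that each summand can be
   controlled separately near [x]. *)
have [b bg ab] : exists2 b : R, (b%:E < g x)%E & a - b < c x.
  case: (g x) agc => [s| |]//=.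
    by rewrite -EFinD lte_fin => h; exists ((a - c x + s) / 2); rewrite ?lte_fin; lra.
  by move=> _; exists (a - c x + 1); [rewrite ltry|lra].
have [V Vx Vb] := lg x b bg.
exists (V `&` [set y | a - b < c y]).
  by apply: filterI => //; exact: (cc x _ (lt_nbhsr ab)).
move=> y [/Vb Vy /= ycb].
have -> : a = b + (a - b) by lra.
by rewrite EFinD; apply: lteD; rewrite ?lte_fin.
Qed.

(** The sublevel sets inside [K] are nested, so they generate a filter, which clusters at some [p]
    in [K]. A value below [g p] is impossible: lower semicontinuity separates a neighbourhood of [p]
    from that sublevel set. *)
Lemma compact_lsc_argmin {T : topologicalType} (g : T -> \bar R) (K : set T) :
  lower_semicontinuous g -> (forall y, g y != -oo%E) ->
  compact K -> K !=set0 ->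
  exists2 p, K p & forall y, K y -> (g p <= g y)%E.
Proof.
move=> lg gNy cK [k Kk].
pose B z := [set y | K y /\ (g y <= g z)%E].
have FF : ProperFilter (filter_from K B).
  apply: filter_from_proper; last by move=> z Kz; exists z; split.
  apply: filter_from_filter; first by exists k.
  move=> y z Ky Kz; have [yz|zy] := leP (g y) (g z).
    by exists y => // w [Kw wy]; do 2!split => //; exact: le_trans yz.
  by exists z => // w [Kw wz]; do 2!split => //; exact: le_trans (ltW zy).
have [|p [Kp clp]] := cK _ FF; first by exists k => // y [].
exists p => // y Ky; rewrite leNgt; apply/negP => gyp.
have [a ya ap] : exists2 a : R, (g y <= a%:E)%E & (a%:E < g p)%E.
  case: (g y) (gNy y) gyp => [s _ sp| _|//].
    by exists s.
  by rewrite ltNge leey.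
have [V Vp Va] := lg p a ap.
have [w [[_ wy] /Va aw]] := clp (B y) V (ex_intro2 _ _ y Ky (fun _ => id)) Vp.
by have := le_lt_trans (le_trans wy ya) aw; rewrite ltxx.
Qed.

(** The sublevel set of [y0] is closed and bounded, hence compact; a minimizer on it is global since
    [g] exceeds [g y0] elsewhere. *)
Lemma coercive_lsc_argmin {d : nat} (g : 'rV[R]_d -> \bar R) y0 :
  lower_semicontinuous g -> (forall y, g y != -oo%E) -> (g y0 < +oo)%E ->
  bounded_set [set y | (g y <= g y0)%E] -> argmin g !=set0.
Proof.
move=> lg gNy gy0 bK.
have cK : closed [set y | (g y <= g y0)%E].
  have -> : [set y | (g y <= g y0)%E] = ~` [set y | ((fine (g y0))%:E < g y)%E].
    apply/seteqP; split => y /=; rewrite fineK ?fin_numE ?gNy ?lt_eqF// leNgt => /negP//.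
  by apply: open_closedC; move/lower_semicontinuousP: lg.
have [|p /= py0 pmin] := @compact_lsc_argmin _ g _ lg gNy (bounded_closed_compact bK cK).
  by exists y0 => /=.
exists p => y; have [/pmin//|/ltW] := leP (g y) (g y0).
exact: le_trans.
Qed.

End LowerSemicontinuous.

(** * The proximal model and the one-step inequality *)

Section ProximalStep.
Context {R : realType} {d : nat} (f r : 'rV[R]_d -> \bar R) (L rho : R).
Hypotheses (f_proper : proper_efun f) (f_lsc : lower_semicontinuous f).
Hypotheses (L_ge0 : 0 <= L) (f_smooth : smooth_on_dom f).
Hypotheses (grad_lip : lipschitz_grad L f).
Hypotheses (r_proper : proper_efun r) (r_lsc : lower_semicontinuous r).
Hypotheses (r_wcvx : weakly_convex rho r).

Let F := fine \o f.
Let fE y : f y = (F y)%:E.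
Proof. by rewrite fineK//; apply: (fin_num_dom f L). Qed.

Lemma prox_modelE alpha x y : prox_model f r alpha x y =
  (r y + (dotv (grad f x) (y - x) + (2 * alpha)^-1 * enorm (x - y) ^+ 2)%:E)%E.
Proof. by rewrite /prox_model addeAC -EFinD addeC. Qed.

(* The model is coercive, without convexity of r: the descent lemma bounds
   <grad f x, y - x> + r y from below by phi y - f x - L/2 |x - y|^2. *)
Lemma prox_model_argmin (m alpha : R) x :
  (forall y, (m%:E <= f y + r y)%E) -> 0 < alpha -> alpha * L < 1 ->
  argmin (prox_model f r alpha x) !=set0.
Proof.
move=> mle a0 aL.
have aVL : L < alpha^-1 by rewrite -[alpha^-1]mul1r ltr_pdivlMr// mulrC.
have [rNy [y0]] := r_proper; rewrite /edom/= => ry0.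
pose c (y : 'rV[R]_d) := dotv (grad f x) (y - x) + (2 * alpha)^-1 * enorm (x - y) ^+ 2.
have gE : prox_model f r alpha x = (fun y => (r y + (c y)%:E)%E).
  by apply/funext => y; rewrite prox_modelE.
have xB : continuous (fun y : 'rV[R]_d => x - y).
  by move=> z; apply: continuousB; [exact: cst_continuous|].
have Bx : continuous (fun y : 'rV[R]_d => y - x).
  by move=> z; apply: continuousB; [|exact: cst_continuous].
have c1 : continuous (fun y : 'rV[R]_d => dotv (grad f x) (y - x)).
  by apply: continuous_dotv => // z; exact: cst_continuous.
have c2 : continuous (fun y : 'rV[R]_d => enorm (x - y) ^+ 2).
  by under eq_fun do rewrite enorm_sqr; exact: continuous_dotv.
have cc : continuous c.
  move=> y; apply: (continuousD (c1 y)); apply: (continuousM _ (c2 y)).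
  exact: cst_continuous.
have gNy y : prox_model f r alpha x y != -oo%E.
  by rewrite gE adde_eq_ninfty negb_or rNy.
apply: (@coercive_lsc_argmin _ _ _ y0) => //.
- by rewrite gE; exact: lower_semicontinuousD.
- by rewrite gE lte_add_pinfty ?ltry.
have [s sE] : exists s, prox_model f r alpha x y0 = s%:E.
  by rewrite gE; case: (r y0) (rNy y0) ry0 => // s _ _; exists (s + c y0).
(* [k] is the quadratic growth left after the descent lemma; [N] turns the resulting bound on the
   squared distance into one on the norm through e <= 1 + e^2. *)
pose k := (2 * alpha)^-1 - L / 2.
have k0 : 0 < k by rewrite /k invfM; lra.
pose N := enorm x + (1 + (s - (m - F x)) / k).
exists N; split; first exact: num_real.
move=> M NM y /=; rewrite sE => gy.
apply: le_trans (norm_le_enorm _) _; apply: le_trans (ltW NM).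
have -> : y = x + (y - x) by rewrite subrKC.
apply: le_trans (enormD _ _) _; rewrite lerD2l.
have e2 : enorm (y - x) ^+ 2 * k <= s - (m - F x).
  move: gy (mle y); rewrite gE fE; case: (r y) => [ry| |]//=.
  rewrite -!EFinD !lee_fin /c => gy my.
  have := descent f L f_proper f_lsc L_ge0 f_smooth grad_lip x y.
  rewrite ler_norml -(enormN (y - x)) opprB => /andP[_].
  rewrite -/F /k; move: gy my; lra.
rewrite -ler_pdivlMr// in e2.
have := sqr_ge0 (enorm (y - x) - 1); have := enorm_ge0 (y - x); nra.
Qed.

(** The identity t|y|^2 + (1-t)|p|^2 - |t y + (1-t) p|^2 = t(1-t)|y - p|^2 turns the added quadratic
    into the convexity defect. *)
Lemma weakly_convex_fin (y p : 'rV[R]_d) (ry rp t : R) :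
  r y = ry%:E -> r p = rp%:E -> 0 <= t <= 1 ->
  exists2 rw, r (t *: y + (1 - t) *: p) = rw%:E &
    rw <= t * ry + (1 - t) * rp + rho / 2 * (t * (1 - t) * enorm (y - p) ^+ 2).
Proof.
move=> ryE rpE t01; have := r_wcvx y p t t01; rewrite ryE rpE.
case: (r _) (r_proper.1 (t *: y + (1 - t) *: p)) => [rw| |]// _.
rewrite -!(EFinD, EFinM) lee_fin => h; exists rw => //; move: h.
rewrite !enorm_sqr !dotvE (dotvC p y); lra.
Qed.

(* Compare p with t y + (1 - t) p, divide by t and let t tend to 0. *)
Lemma prox_model_strong_min (alpha : R) (x y p : 'rV[R]_d) (ry : R) :
  0 < alpha -> alpha * rho <= 1 -> argmin (prox_model f r alpha x) p ->
  r y = ry%:E ->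
  exists2 rp, r p = rp%:E &
    dotv (grad f x) (p - x) + rp + (2 * alpha)^-1 * enorm (x - p) ^+ 2
      + ((2 * alpha)^-1 - rho / 2) * enorm (y - p) ^+ 2
    <= dotv (grad f x) (y - x) + ry + (2 * alpha)^-1 * enorm (x - y) ^+ 2.
Proof.
move=> a0 arho pmin ryE.
have [rp rpE] : exists rp, r p = rp%:E.
  have := pmin y; rewrite !prox_modelE ryE.
  by case: (r p) (r_proper.1 p) => [rp| |]// _ _; exists rp.
exists rp => //; set c := (2 * alpha)^-1.
have k0 : 0 <= c - rho / 2.
  have : rho <= alpha^-1 by rewrite -[alpha^-1]mul1r ler_pdivlMr// mulrC.
  by rewrite /c invfM; lra.
set k := c - rho / 2 in k0 *; set e := enorm (y - p) ^+ 2.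
set A := _ + _ + c * _; set B := _ + _ + c * _.
have At t : 0 < t < 1 -> A + k * e * (1 - t) <= B.
  case/andP => t0 t1.
  have [|rw rwE rwle] := weakly_convex_fin y p ry rp t ryE rpE; first by rewrite !ltW.
  have := pmin (t *: y + (1 - t) *: p).
  rewrite !prox_modelE rpE rwE -!EFinD lee_fin -/c => h.
  rewrite -(ler_pM2l t0); move: h rwle.
  rewrite /A /B /k /e !enorm_sqr !dotvE !(dotvC _ x) (dotvC p y).
  set fp := dotv (grad f x) p; set fy := dotv (grad f x) y.
  set fx := dotv (grad f x) x.
  lra.
have ke : 0 <= k * e by rewrite mulr_ge0 ?sqr_ge0.
rewrite leNgt; apply/negP => BA.
(* An explicit [t] in place of a limit: with the gap D = A + k e - B > 0 it gives t k e < D/2,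
   whereas [At] demands t k e >= D. *)
pose t := (A + k * e - B) / (2 * (k * e + (A + k * e - B))).
have D0 : 0 < 2 * (k * e + (A + k * e - B)) by lra.
have tD : t * (2 * (k * e + (A + k * e - B))) = A + k * e - B by rewrite mulfVK// gt_eqF.
have t0 : 0 < t by rewrite divr_gt0// subr_gt0.
have t1 : t < 1 by rewrite /t ltr_pdivrMr//; lra.
have /At := introT andP (conj t0 t1).
have : 0 < t * (A + k * e - B) by rewrite mulr_gt0 ?subr_gt0.
lra.
Qed.

(** The descent lemma replaces the linearization of f by its values at [p] (upper bound) and at [y]
    (lower bound), each at the cost of an L/2 term. The case y = x gives descent, and y a solution
    gives the distance recursion. *)
Lemma prox_step (alpha : R) (x y p : 'rV[R]_d) (ry : R) :
  0 < alpha -> alpha * rho <= 1 -> argmin (prox_model f r alpha x) p ->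
  r y = ry%:E ->
  exists2 rp, r p = rp%:E &
    F p + rp + (alpha^-1 - L) / 2 * enorm (x - p) ^+ 2
      + (alpha^-1 - rho) / 2 * enorm (y - p) ^+ 2
    <= F y + ry + (alpha^-1 + L) / 2 * enorm (x - y) ^+ 2.
Proof.
move=> a0 arho pmin ryE.
have [rp rpE h] := prox_model_strong_min alpha x y p ry a0 arho pmin ryE.
exists rp => //; move: h.
have := descent f L f_proper f_lsc L_ge0 f_smooth grad_lip x y.
have := descent f L f_proper f_lsc L_ge0 f_smooth grad_lip x p.
by rewrite !ler_norml -/F invfM => /andP[_ +] /andP[+ _]; lra.
Qed.

End ProximalStep.

(** The extended inverse of 0 is +oo, matching the convention for 1/0; for b = 0 the product is
    simply 0. *)
Lemma lt_inve_mul {R : realType} (a b : R) :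
  0 <= b -> (a%:E < b%:E^-1)%E -> a * b < 1.
Proof.
move=> b0; rewrite inver; case: eqVneq => [->|bn0]; first by rewrite mulr0 ltr01.
by rewrite lte_fin -[b^-1]mul1r ltr_pdivlMr// lt0r bn0.
Qed.

Lemma minvalE {R : realType} {d : nat} (g : 'rV[R]_d -> \bar R) x :
  argmin g x -> minval g = g x.
Proof.
move=> gx; apply/eqP; rewrite eq_le; apply/andP; split.
  by apply: ereal_inf_lbound; exists x.
by apply: le_ereal_inf_tmp => _ [y _ <-].
Qed.

(** * Descent and contraction of the distance to the solution set *)

Section LinearConvergence.
Context {R : realType} {d : nat} (f r : 'rV[R]_d -> \bar R) (L rho nu alpha : R).
Hypotheses (f_proper : proper_efun f) (f_lsc : lower_semicontinuous f).
Hypotheses (L_ge0 : 0 <= L) (f_smooth : smooth_on_dom f).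
Hypotheses (grad_lip : lipschitz_grad L f).
Hypotheses (r_proper : proper_efun r) (r_lsc : lower_semicontinuous r).
Hypotheses (r_wcvx : weakly_convex rho r).
Hypotheses (phi_min : argmin (f \+ r)%E !=set0).
Hypotheses (alpha_gt0 : 0 < alpha).
Hypotheses (alphaL : alpha * L < 1) (alpharho : alpha * rho < 1).

Local Notation phi := (f \+ r)%E.
Local Notation S := (solutions phi).
Local Notation T := (prox_grad f r alpha).

Let F := fine \o f.
Let fE y : f y = (F y)%:E.
Proof. by rewrite fineK//; apply: (fin_num_dom f L). Qed.

Let alphaVL : 0 < alpha^-1 - L.
Proof. by rewrite subr_gt0 -[alpha^-1]mul1r ltr_pdivlMr// mulrC. Qed.

Let alphaVrho : 0 < alpha^-1 - rho.
Proof. by rewrite subr_gt0 -[alpha^-1]mul1r ltr_pdivlMr// mulrC. Qed.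

Lemma solutions_neq0 : S !=set0.
Proof. by have [z zmin] := phi_min; exists z; rewrite /solutions/= (minvalE _ z). Qed.

Lemma minval_fin : exists s : R, minval phi = s%:E.
Proof.
have [z zmin] := phi_min; rewrite (minvalE _ z zmin).
have [rNy [y]] := r_proper; rewrite /edom/= => ry.
have := zmin y; rewrite /= !fE.
case: (r z) (rNy z) => [rz| |]// _; first by exists (F z + rz).
by case: (r y) ry.
Qed.

Lemma minval_le x : (minval phi <= phi x)%E.
Proof. by apply: ereal_inf_lbound; exists x. Qed.

Lemma fin_le_level x (b : R) : (phi x <= b%:E)%E -> exists rx, r x = rx%:E.
Proof.
by rewrite /= fE; case: (r x) (r_proper.1 x) => [rx| |]// _ _; exists rx.
Qed.

(** [get] is meaningful only on a nonempty set; existence of a minimizer comes from the finite lower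
    bound [minval phi]. *)
Lemma prox_grad_argmin x : argmin (prox_model f r alpha x) (T x).
Proof.
have [s sE] := minval_fin; apply: getPex.
apply: (@prox_model_argmin _ _ f r L _ _ _ _ _ _ _ s) => // y.
by rewrite -sE; exact: minval_le.
Qed.

Lemma prox_grad_descent x : (phi x < +oo)%E -> (phi (T x) <= phi x)%E.
Proof.
move=> phix; have [rx rxE] : exists rx, r x = rx%:E.
  by move: phix; rewrite /= fE; case: (r x) (r_proper.1 x) => [rx| |]//; exists rx.
have [rp rpE h] := prox_step f r L rho f_proper f_lsc L_ge0 f_smooth grad_lip
  r_proper r_wcvx alpha x x (T x) rx alpha_gt0 (ltW alpharho) (prox_grad_argmin x) rxE.
have aL := ltW alphaVL.
have arho := ltW alphaVrho.
rewrite /= !fE rxE rpE -!EFinD lee_fin.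
move: h; rewrite -/F subrr -(scale0r x) enormZ normr0 mul0r.
have := mulr_ge0 aL (sqr_ge0 (enorm (x - T x))).
have := mulr_ge0 arho (sqr_ge0 (enorm (x - T x))).
lra.
Qed.

Lemma level_ge_prox_grad x : level_ge phi nu x -> level_ge phi nu (T x).
Proof.
case/andP => _ xlt; apply/andP; split; first exact: minval_le.
apply: le_lt_trans (xlt); apply: prox_grad_descent.
by apply: lt_le_trans xlt _; rewrite leey.
Qed.

Lemma eucl_dist_prox_grad x :
  (alpha^-1 - rho) * eucl_dist (T x) S ^+ 2 + (alpha^-1 - L) * enorm (x - T x) ^+ 2
    <= (alpha^-1 + L) * eucl_dist x S ^+ 2.
Proof.
have aL := ltW alphaVL.
have arho := ltW alphaVrho.
have [s sE] := minval_fin.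
set Q := (X in X <= _).
have Q0 : 0 <= Q by rewrite addr_ge0// mulr_ge0 ?sqr_ge0.
have aL0 : 0 < alpha^-1 + L by rewrite ltr_wpDr ?invr_gt0.
have Qn : 0 <= Q / (alpha^-1 + L) by rewrite divr_ge0// ltW.
(* No nearest solution is chosen: solving for the distance leaves a bound to check against every [y]
   in [S]. *)
suff h : Num.sqrt (Q / (alpha^-1 + L)) <= eucl_dist x S.
  rewrite mulrC -ler_pdivrMr// -[leLHS]sqr_sqrtr//.
  by rewrite ler_pXn2r ?nnegrE ?sqrtr_ge0// eucl_dist_ge0//; exact: solutions_neq0.
apply: le_eucl_dist; first exact: solutions_neq0.
move=> y Sy; rewrite -(@ler_pXn2r _ 2) ?nnegrE ?sqrtr_ge0 ?enorm_ge0//.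
rewrite sqr_sqrtr// ler_pdivrMr//.
have [ry ryE] : exists ry, r y = ry%:E by apply: (fin_le_level y s); rewrite -sE.
have [rp rpE h] := prox_step f r L rho f_proper f_lsc L_ge0 f_smooth grad_lip
  r_proper r_wcvx alpha x y (T x) ry alpha_gt0 (ltW alpharho) (prox_grad_argmin x) ryE.
have := le_trans Sy (minval_le (T x)).
rewrite /= !fE ryE rpE -!EFinD lee_fin => yp.
have dy := eucl_dist_le (T x) y S Sy.
have : eucl_dist (T x) S ^+ 2 <= enorm (y - T x) ^+ 2.
  rewrite -(enormN (y - T x)) opprB ler_pXn2r ?nnegrE ?enorm_ge0//.
  by apply: eucl_dist_ge0; exact: solutions_neq0.
rewrite /Q => /(ler_wpM2l arho); move: h yp; rewrite -/F; lra.
Qed.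

Lemma prox_grad_contraction (c : R) : 0 <= rho -> 0 < c ->
  alpha * ((c ^+ 2 + 1) * (L + rho)) < 1 ->
  level_PEB f r alpha nu c ->
  exists beta : R, 0 < beta < 1 /\ forall x, level_ge phi nu x ->
    eucl_dist (T x) S <= beta * eucl_dist x S.
Proof.
move=> rho0 c0 small peb.
have small' : (c ^+ 2 + 1) * (L + rho) < alpha^-1.
  by rewrite -[alpha^-1]mul1r ltr_pdivlMr// mulrC.
have c20 : 0 < c ^+ 2 by rewrite exprn_gt0.
have D0 : 0 < (alpha^-1 - rho) * c ^+ 2 by rewrite mulr_gt0.
(* Multiply the recursion by c^2 and bound c^2 |x - T x|^2 below by the squared distance of x, as
   the error bound allows; solving for the squared distance of T x gives the factor [q]. *)
pose q := ((alpha^-1 + L) * c ^+ 2 - (alpha^-1 - L)) / ((alpha^-1 - rho) * c ^+ 2).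
have q1 : q < 1 by rewrite /q ltr_pdivrMr// mul1r; lra.
(* The sign of [q] is not known; the maximum with 1/4 keeps beta inside (0,1). *)
pose b := Num.max q 4^-1; have b1 : b < 1 by rewrite gt_max q1 invf_lt1//=; lra.
have b0 : 0 < b by rewrite lt_max invr_gt0 ltr0n orbT.
exists (Num.sqrt b); split.
  by rewrite sqrtr_gt0 b0 -sqrtr1 ltr_sqrt.
move=> x xlev.
have dist_ge0 y : 0 <= eucl_dist y S by apply: eucl_dist_ge0; exact: solutions_neq0.
rewrite -(@ler_pXn2r _ 2) ?nnegrE ?mulr_ge0 ?sqrtr_ge0// exprMn (sqr_sqrtr (ltW b0)).
have h : (alpha^-1 - L) * eucl_dist x S ^+ 2
    <= (alpha^-1 - L) * (c ^+ 2 * enorm (x - T x) ^+ 2).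
  apply: ler_wpM2l; first exact: ltW alphaVL.
  rewrite -exprMn ler_pXn2r ?nnegrE ?mulr_ge0 ?enorm_ge0 ?dist_ge0 ?(ltW c0)//.
  exact: peb.
have := ler_wpM2l (ltW c20) (eucl_dist_prox_grad x).
have qb : q * eucl_dist x S ^+ 2 <= b * eucl_dist x S ^+ 2.
  by apply: ler_wpM2r; rewrite ?sqr_ge0// le_max lexx.
move=> h2; apply: le_trans qb; rewrite /q mulrAC ler_pdivlMr//; move: h h2; lra.
Qed.

End LinearConvergence.

(** * Equivalence of the error bound and linear convergence *)

Theorem theorem1 (R : realType) (d : nat) (f r : 'rV[R]_d -> \bar R)
    (L rho nu : R)
    (f_proper : proper_efun f) (f_lsc : lower_semicontinuous f)
    (f_smooth : smooth_on_dom f)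
    (L_ge0 : 0 <= L) (f_lip : lipschitz_grad L f)
    (r_proper : proper_efun r) (r_lsc : lower_semicontinuous r)
    (rho_ge0 : 0 <= rho) (r_wcvx : weakly_convex rho r)
    (phi_min : argmin (f \+ r)%E !=set0)
    (phi_bounded : exists m : R, forall x, (m%:E <= (f \+ r) x)%E)
    (nu_gt0 : 0 < nu) :
  (* (i) *)
  (forall alpha c1 : R, 0 < c1 -> level_PEB f r alpha nu c1 ->
     0 < alpha -> (alpha%:E < ((c1 ^+ 2 + 1) * (L + rho))%:E^-1)%E ->
     forall x0, level_gt (f \+ r)%E nu x0 ->
       exists beta : R, 0 < beta < 1 /\ pgm_linear f r alpha beta x0)
  /\
  (* (ii) *)
  (forall alpha : R,
     0 < alpha -> (alpha%:E < mine L%:E^-1 rho%:E^-1)%E ->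
     (exists beta : R, 0 < beta < 1 /\
        forall x0, level_gt (f \+ r)%E nu x0 -> pgm_linear f r alpha beta x0) ->
     exists c1 : R, 0 < c1 /\ level_PEB f r alpha nu c1).
Proof.
split.
  move=> alpha c c0 peb a0 /lt_inve_mul small x0 /andP[/ltW x0ge x0lt].
  have {}small : alpha * ((c ^+ 2 + 1) * (L + rho)) < 1.
    by apply: small; rewrite mulr_ge0 ?addr_ge0 ?sqr_ge0.
  (* Nonnegativity of all terms lets the single stepsize bound imply both [alpha * L < 1] and
     [alpha * rho < 1]. *)
  have cL : 0 <= alpha * (c ^+ 2 * (L + rho)).
    by rewrite !mulr_ge0 ?sqr_ge0 ?addr_ge0// ltW.
  have aL0 : 0 <= alpha * L by rewrite mulr_ge0// ltW.
  have arho0 : 0 <= alpha * rho by rewrite mulr_ge0// ltW.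
  have aL : alpha * L < 1 by lra.
  have arho : alpha * rho < 1 by lra.
  have [beta [beta01 contr]] := prox_grad_contraction f r L rho nu alpha
    f_proper f_lsc L_ge0 f_smooth f_lip r_proper r_lsc r_wcvx phi_min a0 aL arho
    c rho_ge0 c0 small peb.
  exists beta; split=> // S k; apply: contr.
  elim: k => [|k IHk]; first by apply/andP.
  exact: (level_ge_prox_grad f r L rho nu alpha).
move=> alpha _ _ [beta [/andP[beta0 beta1] lin]].
have S0 : solutions (f \+ r)%E !=set0.
  by have [z zmin] := phi_min; exists z; rewrite /solutions/= (minvalE _ z).
(* Solving D(x) <= |x - x'| + beta D(x) for D(x) yields this constant. *)
exists (1 - beta)^-1; split; first by rewrite invr_gt0 subr_gt0.
(* Minimizers belong to [level_ge] but not to [level_gt], so [lin] is silent there; their distance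
   to the solutions is 0. *)
move=> x /andP[]; rewrite le_eqVlt => /orP[/eqP xmin _|xgt xlt].
  apply: (@le_trans _ _ 0).
    apply: le_trans (eucl_dist_le x x _ _) _; first by rewrite /solutions/= xmin.
    by rewrite subrr -(scale0r x) enormZ normr0 mul0r.
  by rewrite mulr_ge0 ?enorm_ge0// invr_ge0 subr_ge0 ltW.
have := lin x (introT andP (conj xgt xlt)) 0; rewrite /= => lin0.
rewrite mulrC ler_pdivlMr ?subr_gt0//.
have := eucl_distD x (prox_grad f r alpha x) _ S0; lra.
Qed.
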